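(* There is a Baire-1 map $f\colon [0,1]\to \mathcal{K}(\mathbb{R}^2)$ such that $\bigcup \{f(s): s\in [0,1]\}$ is a subset of the plane $\mathbb{R}^2$ with zero area (two-dimensional Lebesgue measure zero) and, for each $s\in[0,1]$, $f(s)$ is a unit line segment of slope $s$.
   Context: $\mathcal{K}(\mathbb{R}^2)$ denotes the set of non-empty compact subsets of the plane $\mathbb{R}^2$, equipped with the Hausdorff metric $d_H$ (induced by the Euclidean metric on $\mathbb{R}^2$). A map is Baire-1 if it is a pointwise limit of a sequence of continuous functions; here, $f\colon[0,1]\to\mathcal{K}(\mathbb{R}^2)$ is Baire-1 if there are continuous maps $f_n\colon[0,1]\to(\mathcal{K}(\mathbb{R}^2),d_H)$, $n\in\mathbb{N}$, with $f_n(s)\to f(s)$ in $d_H$ for every $s\in[0,1]$. A unit line segment is a closed line segment of length $1$ in $\mathbb{R}^2$; it has slope $s$ if it is contained in a line of the form $\{(x,y): y=sx+c\}$ for some $c\in\mathbb{R}$. *)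

(* Defs.v *)
From HB Require Import structures.
From mathcomp Require Import all_boot all_order all_algebra.
From mathcomp Require Import all_classical all_reals all_analysis.
From mathcomp Require Import ring lra.

Set Implicit Arguments.
Unset Strict Implicit.
Unset Printing Implicit Defensive.

Import Order.TTheory GRing.Theory Num.Theory.
Import numFieldNormedType.Exports.

Local Open Scope classical_set_scope.
Local Open Scope ring_scope.

Section Plane.
Context {R : realType}.
Implicit Types (p q r : R * R) (A B : set (R * R)).

(* The library equips R * R with the sup norm, which gives the right topology
   (hence the right compact sets) but not the Euclidean metric. *)
Definition edist2 p q : R :=
  Num.sqrt ((p.1 - q.1) ^+ 2 + (p.2 - q.2) ^+ 2).

Definition dist_to A p : R := inf [set edist2 p a | a in A].

(* With the junk values of [sup] and [inf] this is meaningful only for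
   non-empty bounded sets. *)
Definition hausdorff_dist A B : R :=
  Num.max (sup [set dist_to B a | a in A]) (sup [set dist_to A b | b in B]).

Lemma edist2_ge0 p q : 0 <= edist2 p q.
Proof. exact: sqrtr_ge0. Qed.

Lemma edist2xx p : edist2 p p = 0.
Proof. by rewrite /edist2 !subrr expr0n /= addr0 sqrtr0. Qed.

Lemma edist2_sym p q : edist2 p q = edist2 q p.
Proof. by rewrite /edist2 -sqrrN opprB -[X in _ + X]sqrrN opprB. Qed.

Lemma edist2_triangle q p r : edist2 p r <= edist2 p q + edist2 q r.
Proof.
rewrite /edist2.
set a := p.1 - q.1; set b := p.2 - q.2; set c := q.1 - r.1; set d := q.2 - r.2.
have -> : p.1 - r.1 = a + c by rewrite /a /c; ring.
have -> : p.2 - r.2 = b + d by rewrite /b /d; ring.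
have u0 : 0 <= a ^+ 2 + b ^+ 2 by rewrite addr_ge0 ?sqr_ge0.
have v0 : 0 <= c ^+ 2 + d ^+ 2 by rewrite addr_ge0 ?sqr_ge0.
rewrite -ler_sqr ?nnegrE ?addr_ge0 ?sqrtr_ge0 //.
rewrite sqr_sqrtr ?addr_ge0 ?sqr_ge0 // [leRHS]sqrrD !sqr_sqrtr //.
have cs : a * c + b * d
    <= Num.sqrt (a ^+ 2 + b ^+ 2) * Num.sqrt (c ^+ 2 + d ^+ 2).
  rewrite -sqrtrM // (le_trans (ler_norm _)) // -sqrtr_sqr ler_wsqrtr //.
  have -> : (a ^+ 2 + b ^+ 2) * (c ^+ 2 + d ^+ 2)
    = (a * c + b * d) ^+ 2 + (a * d - b * c) ^+ 2 by ring.
  by rewrite lerDl sqr_ge0.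
rewrite -mulr_natl; move: cs; lra.
Qed.

Lemma ball_edist2 p q (e : R) : edist2 p q < e -> ball p e q.
Proof.
move=> pq.
have h1 : `|p.1 - q.1| <= edist2 p q.
  by rewrite -sqrtr_sqr ler_wsqrtr // lerDl sqr_ge0.
have h2 : `|p.2 - q.2| <= edist2 p q.
  by rewrite -sqrtr_sqr ler_wsqrtr // lerDr sqr_ge0.
by split; rewrite /ball /=; apply: le_lt_trans pq.
Qed.

Lemma edist2_ball p q (e : R) : ball p e q -> edist2 p q <= 2 * e.
Proof.
move=> [h1 h2]; move: h1 h2; rewrite /ball /= => h1 h2.
have e0 : 0 < e by exact: le_lt_trans h1.
rewrite -(ger0_norm (_ : 0 <= 2 * e)); last by rewrite mulr_ge0 // ltW.
rewrite -sqrtr_sqr ler_wsqrtr //.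
have s1 : (p.1 - q.1) ^+ 2 <= e ^+ 2.
  by rewrite -real_normK ?num_real // lerXn2r ?nnegrE ?normr_ge0 ?(ltW h1) ?ltW.
have s2 : (p.2 - q.2) ^+ 2 <= e ^+ 2.
  by rewrite -real_normK ?num_real // lerXn2r ?nnegrE ?normr_ge0 ?(ltW h2) ?ltW.
have := sqr_ge0 e; rewrite exprMn; move: s1 s2; lra.
Qed.

Lemma compact_edist2_bounded A : compact A ->
  exists M : R, forall p q, A p -> A q -> edist2 p q <= M.
Proof.
move=> cA.
have [M [_ HM]] := @compact_bounded R (R^o * R^o)%type A cA.
pose N : R := `|M| + 1.
have key r : A r -> edist2 (0, 0) r <= 2 * (N + 1).
  move=> Ar; apply: edist2_ball.
  have MN : M < N by rewrite /N; have := ler_norm M; lra.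
  have := HM N MN r Ar; rewrite /= prod_normE ge_max => /andP[/= r1 r2].
  by split; rewrite /ball /= sub0r normrN; move: r1 r2; lra.
exists (2 * (2 * (N + 1))) => p q Ap Aq.
apply: le_trans (edist2_triangle (0, 0) p q) _.
by rewrite (edist2_sym p); have := key p Ap; have := key q Aq; lra.
Qed.

Lemma dist_to_le A p a : A a -> dist_to A p <= edist2 p a.
Proof.
move=> Aa; apply: ge_inf; last by exists a.
by exists 0 => _ [b _ <-]; exact: edist2_ge0.
Qed.

Lemma dist_to_adherent A p (e : R) : A !=set0 -> dist_to A p < e ->
  exists2 a, A a & edist2 p a < e.
Proof.
move=> [a0 Aa0] pe.
have hi : has_inf [set edist2 p a | a in A].
  split; first by exists (edist2 p a0), a0.
  by exists 0 => _ [b _ <-]; exact: edist2_ge0.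
have [|_ [a Aa <-]] := inf_adherent (eps := e - dist_to A p) _ hi.
  by rewrite subr_gt0.
by rewrite addrC subrK => h; exists a.
Qed.

Lemma dist_to_ge0 A p : A !=set0 -> 0 <= dist_to A p.
Proof.
move=> [a Aa]; apply: lb_le_inf; first by exists (edist2 p a), a.
by move=> _ [b _ <-]; exact: edist2_ge0.
Qed.

End Plane.

Record compacts2 (R : realType) := Compacts2 {
  compacts2_set :> set (R * R) ;
  compacts2_nonempty : compacts2_set !=set0 ;
  compacts2_compact : compact compacts2_set }.

HB.instance Definition _ (R : realType) := gen_eqMixin (compacts2 R).
HB.instance Definition _ (R : realType) := gen_choiceMixin (compacts2 R).

Section HausdorffMetric.
Context {R : realType}.
Implicit Types A B C : compacts2 R.

Lemma compacts2_inj A B : A = B :> set (R * R) -> A = B.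
Proof.
case: A => A A0 Ac; case: B => B B0 Bc /= AB; subst B.
by congr Compacts2; exact: Prop_irrelevance.
Qed.

Lemma has_sup_dist_to A B : has_sup [set dist_to B a | a in A : set (R * R)].
Proof.
have [a0 Aa0] := compacts2_nonempty A; have [b0 Bb0] := compacts2_nonempty B.
have [M HM] := compact_edist2_bounded (@compacts2_compact R A).
split; first by exists (dist_to B a0), a0.
exists (M + edist2 a0 b0) => _ [a Aa <-].
apply: le_trans (dist_to_le _ Bb0) _.
by apply: le_trans (edist2_triangle a0 _ _) _; rewrite lerD2r HM.
Qed.

Lemma hausdorff_dist_lel A B a : compacts2_set A a -> dist_to B a <= hausdorff_dist A B.
Proof.
move=> Aa; rewrite /hausdorff_dist le_max; apply/orP; left.
by apply: ub_le_sup; [exact: (has_sup_dist_to A B).2|exists a].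
Qed.

Lemma hausdorff_dist_sym A B : hausdorff_dist A B = hausdorff_dist B A.
Proof. by rewrite /hausdorff_dist maxC. Qed.

Lemma hausdorff_dist_ler A B b : compacts2_set B b -> dist_to A b <= hausdorff_dist A B.
Proof. by rewrite hausdorff_dist_sym; exact: hausdorff_dist_lel. Qed.

Lemma hausdorff_dist_le A B (e : R) :
  (forall a, compacts2_set A a -> dist_to B a <= e) -> (forall b, compacts2_set B b -> dist_to A b <= e) ->
  hausdorff_dist A B <= e.
Proof.
move=> HA HB; rewrite /hausdorff_dist ge_max; apply/andP; split.
- apply: ge_sup; first exact: (has_sup_dist_to A B).1.
  by move=> _ [a Aa <-]; exact: HA.
- apply: ge_sup; first exact: (has_sup_dist_to B A).1.
  by move=> _ [a Aa <-]; exact: HB.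
Qed.

Lemma hausdorff_dist_ge0 A B : 0 <= hausdorff_dist A B.
Proof.
have [a Aa] := compacts2_nonempty A.
apply: le_trans (hausdorff_dist_lel B Aa).
exact/dist_to_ge0/compacts2_nonempty.
Qed.

Lemma hausdorff_distxx A : hausdorff_dist A A = 0.
Proof.
apply/eqP; rewrite eq_le hausdorff_dist_ge0 andbT.
by apply: hausdorff_dist_le => a Aa; rewrite -(edist2xx a) dist_to_le.
Qed.

Lemma hausdorff_dist_subset A B : hausdorff_dist A B = 0 ->
  (A : set (R * R)) `<=` B.
Proof.
move=> AB0 a Aa.
have clB : closed (B : set (R * R)).
  apply: compact_closed; last exact: compacts2_compact.
  exact: (@norm_hausdorff _ (R^o * R^o)%type).
apply: clB => U /nbhs_ballP[e /= e0 aU].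
have [|b Bb ab] := @dist_to_adherent R B a e (compacts2_nonempty B).
  by apply: le_lt_trans (hausdorff_dist_lel B Aa) _; rewrite AB0.
by exists b; split => //; apply: aU; exact: ball_edist2.
Qed.

Lemma hausdorff_dist_positivity A B : hausdorff_dist A B = 0 -> A = B.
Proof.
move=> AB; apply: compacts2_inj; apply/seteqP; split.
  exact: hausdorff_dist_subset.
by apply: hausdorff_dist_subset; rewrite hausdorff_dist_sym.
Qed.

Lemma dist_to_triangle A B C a : compacts2_set A a ->
  dist_to C a <= hausdorff_dist A B + hausdorff_dist B C.
Proof.
move=> Aa; apply/ler_addgt0Pl => e e0.
have e20 : 0 < e / 2 by rewrite divr_gt0.
have [|b Bb ab] := @dist_to_adherent R B a (hausdorff_dist A B + e / 2)
  (compacts2_nonempty B).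
  by apply: le_lt_trans (hausdorff_dist_lel B Aa) _; rewrite ltrDl.
have [|c Cc bc] := @dist_to_adherent R C b (hausdorff_dist B C + e / 2)
  (compacts2_nonempty C).
  by apply: le_lt_trans (hausdorff_dist_lel C Bb) _; rewrite ltrDl.
apply: le_trans (dist_to_le _ Cc) _.
apply: le_trans (edist2_triangle b _ _) _.
move: ab bc; lra.
Qed.

Lemma hausdorff_dist_triangle B A C :
  hausdorff_dist A C <= hausdorff_dist A B + hausdorff_dist B C.
Proof.
apply: hausdorff_dist_le => [a Aa|c Cc]; first exact: dist_to_triangle.
rewrite addrC (hausdorff_dist_sym A B) (hausdorff_dist_sym B C).
exact: dist_to_triangle.
Qed.

End HausdorffMetric.

HB.instance Definition _ (R : realType) :=
  @isMetric.Build R (compacts2 R) (fun A B => hausdorff_dist A B)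
    hausdorff_distxx hausdorff_dist_positivity
    hausdorff_dist_sym hausdorff_dist_triangle.

(* A map A -> Y is represented by a total function X -> Y, whose values outside
   A are irrelevant. *)
Definition baire1 (X Y : topologicalType) (f : X -> Y) (A : set X) : Prop :=
  exists f_ : nat -> X -> Y,
    (forall n, {within A, continuous (f_ n)}) /\
    (forall x, A x -> f_ n x @[n --> \oo] --> f x).

Definition segment2 (R : realType) (a b : R * R) : set (R * R) :=
  [set ((1 - t) * a.1 + t * b.1, (1 - t) * a.2 + t * b.2) | t in `[0, 1]].

Definition unit_segment (R : realType) (S : set (R * R)) : Prop :=
  exists a b : R * R, edist2 a b = 1 /\ S = segment2 a b.

Definition has_slope (R : realType) (s : R) (S : set (R * R)) : Prop :=
  exists c : R, S `<=` [set p | p.2 = s * p.1 + c].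

(* Main.v *)
Require Import Defs.
From mathcomp Require Import all_boot all_order all_algebra.
From mathcomp Require Import all_classical all_reals all_analysis.
From mathcomp Require Import measurable_realfun ring lra.

Import Order.TTheory GRing.Theory Num.Theory.
Import numFieldNormedType.Exports.

Local Open Scope classical_set_scope.
Local Open Scope ring_scope.

(** The segment of slope [s] is cut out of the line [y = s * x - H s] over
[0 <= x <= 1 / sqrt (1 + s^2)], so everything depends on the choice of [H].
Write [s] in base 2 as [s = sum_n d_n / 2^n] with digits [d_n] equal to 0 or 1,
and put [H s = sum_n a_n * d_n / 2^n] for a sequence [a] in [[0, 1]]. Then the
point of the line above [x] has ordinate
[[
  s * x - H s = sum_n (x - a_n) * d_n / 2^n.
]]

Null area. Suppose that [a] is constantly equal to [b] on [k <= n < k + m].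
Up to an error of [2 / 2^k * (|x - b| + 1 / 2^m)] this ordinate is determined
by the first [k] digits of [s] ([line_near_truncation]). As there are only
[2^k] strings of [k] digits, all the ordinates above [x], for all [s] together,
lie in a set of measure at most [4 * (|x - b| + 1 / 2^m)]. The sequence [a] is
taken constant on each dyadic block [2^j <= n < 2^(j+1)], with a value
[b = dyadic j], and the values [dyadic j] come arbitrarily close to any [x] in
[[0, 1]] for arbitrarily large [j] ([dyadic_near]). Hence every vertical
section is null, and so is the union of the segments, by Fubini
([kakeya_cover_negligible]).

Baire class 1. The digits come from the doubling map: [d_n] is 1 when the
[n]-th iterate is at least 1, and one passes from [v] to [2 * (v - d_n)].
Replacing the jump at 1 by a steep continuous ramp gives functions [H_N],
truncated to [N] terms, which are continuous. For fixed [s], any given number of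
the digits is eventually unchanged by the replacement, and the remaining digits
contribute little, so [H_N s] tends to [H s] ([wsum_ramp_cvg]). Finally a
segment depends continuously on its end points for the Hausdorff distance
([cvg_segment]). *)

(** * Segments and the Hausdorff distance *)

Section Segments.
Context {R : realType}.
Implicit Types a b p q : R * R.

Lemma segment2_nonempty a b : segment2 a b !=set0.
Proof.
exists ((1 - 0) * a.1 + 0 * b.1, (1 - 0) * a.2 + 0 * b.2), 0 => //=.
by rewrite in_itv/= lexx ler01.
Qed.

Lemma segment2_compact a b : compact (segment2 a b).
Proof.
apply: continuous_compact; last exact: segment_compact.
apply: continuous_subspaceT => t.
have aff (u v : R) : (1 - r) * u + r * v @[r --> t] --> (1 - t) * u + t * v.
  by apply: cvgD; apply: cvgMl => //; apply: cvgB => //; exact: cvg_cst.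
rewrite /continuous_at; exact: (cvg_pair (aff a.1 b.1) (aff a.2 b.2)).
Qed.

Definition segment a b : compacts2 R :=
  Compacts2 (segment2_nonempty a b) (segment2_compact a b).

Lemma edist2_norm p q : edist2 p q <= `|p.1 - q.1| + `|p.2 - q.2|.
Proof.
rewrite /edist2 -[leRHS]ger0_norm ?addr_ge0// -sqrtr_sqr ler_wsqrtr//.
rewrite [leRHS]sqrrD !(real_normK (num_real _)) lerD2r lerDl.
by rewrite mulrn_wge0// mulr_ge0.
Qed.

(** The point of parameter [t] on one segment is compared with the point of the
same parameter on the other one. *)
Lemma dist_to_segment2 a b a' b' p : segment2 a b p ->
  dist_to (segment2 a' b') p <=
  (`|a.1 - a'.1| + `|a.2 - a'.2|) + (`|b.1 - b'.1| + `|b.2 - b'.2|).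
Proof.
move=> [t /=]; rewrite in_itv/= => /andP[t0 t1] <-.
apply: le_trans (dist_to_le _ (_ : segment2 a' b'
  ((1 - t) * a'.1 + t * b'.1, (1 - t) * a'.2 + t * b'.2))) _.
  by exists t => //=; rewrite in_itv/= t0.
apply: le_trans (edist2_norm _ _) _ => /=.
have coord (u v u' v' : R) :
    `|(1 - t) * u + t * v - ((1 - t) * u' + t * v')| <= `|u - u'| + `|v - v'|.
  have -> : (1 - t) * u + t * v - ((1 - t) * u' + t * v') =
      (1 - t) * (u - u') + t * (v - v') by ring.
  apply: le_trans (ler_normD _ _) _; rewrite !normrM.
  rewrite (ger0_norm t0) ger0_norm ?subr_ge0//.
  by apply: lerD; rewrite ler_piMl// lerBlDr lerDl.
have := coord a.1 b.1 a'.1 b'.1; have := coord a.2 b.2 a'.2 b'.2; lra.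
Qed.

Lemma hausdorff_dist_segment a b a' b' :
  hausdorff_dist (segment a b) (segment a' b') <=
  (`|a.1 - a'.1| + `|a.2 - a'.2|) + (`|b.1 - b'.1| + `|b.2 - b'.2|).
Proof.
apply: hausdorff_dist_le => p; first exact: dist_to_segment2.
by move=> /(@dist_to_segment2 _ _ a b); rewrite (distrC a.1) (distrC a.2)
  (distrC b.1) (distrC b.2).
Qed.

Lemma cvg_segment (T : Type) (F : set_system T) (FF : Filter F)
    (a b : T -> R * R) a0 b0 :
  (a x).1 @[x --> F] --> a0.1 -> (a x).2 @[x --> F] --> a0.2 ->
  (b x).1 @[x --> F] --> b0.1 -> (b x).2 @[x --> F] --> b0.2 ->
  segment (a x) (b x) @[x --> F] --> segment a0 b0.
Proof.
move=> a1 a2 b1 b2; apply/cvg_ballP => e e0.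
have e40 : 0 < e / 4 by lra.
move/cvgrPdist_lt/(_ _ e40): a1 => a1; move/cvgrPdist_lt/(_ _ e40): a2 => a2.
move/cvgrPdist_lt/(_ _ e40): b1 => b1; move/cvgrPdist_lt/(_ _ e40): b2 => b2.
near=> x; rewrite ballEmdist/= /mdist/=.
apply: le_lt_trans (hausdorff_dist_segment _ _ _ _) _.
have := near a1 x; have := near a2 x; have := near b1 x; have := near b2 x.
move=> /(_ ltac:(done)) h1 /(_ ltac:(done)) h2 /(_ ltac:(done)) h3.
move=> /(_ ltac:(done)) h4; lra.
Unshelve. all: by end_near. Qed.

End Segments.

(** * Binary expansions and the height function *)

Section Expansions.
Context {R : realType}.
Implicit Types (phi : R -> R) (a : nat -> R) (t : R).

(** For [phi = jump] this is the doubling map, whose iterates are the remainders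
of the greedy binary expansion, with an integer part that is 0 or 1. The
threshold function [phi] is kept arbitrary so that the jump can be replaced by a
continuous function. *)
Fixpoint doubling_orbit phi t n : R :=
  if n is m.+1
  then 2 * (doubling_orbit phi t m - phi (doubling_orbit phi t m)) else t.

Definition digit phi t n : R := phi (doubling_orbit phi t n).

Definition wsum a phi t k : R := \sum_(n < k) a n * digit phi t n / 2 ^+ n.

Definition jump (v : R) : R := (1 <= v)%R%:R.

Lemma jump_itv v : 0 <= jump v <= 1.
Proof. by rewrite /jump; case: (1 <= v); rewrite ?lexx ?ler01. Qed.

Lemma wsumS a phi t k :
  wsum a phi t k.+1 = wsum a phi t k + a k * digit phi t k / 2 ^+ k.
Proof. by rewrite /wsum big_ord_recr. Qed.

Lemma wsum0 a phi t : wsum a phi t 0 = 0.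
Proof. by rewrite /wsum big_ord0. Qed.

(** This holds for any threshold function: each step only moves [phi] of the
remainder into the sum. *)
Lemma expansion phi t k :
  t = wsum (fun=> 1) phi t k + doubling_orbit phi t k / 2 ^+ k.
Proof.
elim: k => [|k IH]; first by rewrite wsum0 expr0 divr1 add0r.
rewrite wsumS {1}IH -addrA mul1r /= /digit exprS invfM.
by congr (_ + _); field; rewrite expf_neq0// pnatr_eq0.
Qed.

Lemma orbit_jump t n : 0 <= t <= 1 -> 0 <= doubling_orbit jump t n <= 2.
Proof.
move=> t01; elim: n => [|n] /=; first lra.
by rewrite /jump; case: (leP 1 (doubling_orbit jump t n)) => /= ? ?; lra.
Qed.

Section Monotone.
Variables (a : nat -> R) (phi : R -> R).
Hypothesis a01 : forall n, 0 <= a n <= 1.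
Hypothesis phi01 : forall v, 0 <= phi v <= 1.

Lemma wterm_itv t n : 0 <= a n * digit phi t n / 2 ^+ n <= (2 ^+ n)^-1.
Proof.
have i0 : 0 <= (2 ^+ n)^-1 :> R by rewrite invr_ge0 exprn_ge0.
have /andP[a0 a1] := a01 n; have /andP[p0 p1] := phi01 (doubling_orbit phi t n).
rewrite mulr_ge0 ?mulr_ge0//= ler_piMl// -[leRHS]mulr1.
exact: ler_pM.
Qed.

(** The second inequality says that the partial sum increased by the sum
[2 / 2 ^+ n] of the missing geometric series decreases with [n]; it bounds the
tails without any infinite sum. *)
Lemma wsum_bounds t k n : (k <= n)%N ->
  wsum a phi t k <= wsum a phi t n
  /\ wsum a phi t n + 2 / 2 ^+ n <= wsum a phi t k + 2 / 2 ^+ k.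
Proof.
move=> /subnK <-; elim: (n - k)%N => [|m IH]; first by rewrite add0n.
rewrite addSn wsumS; have := wterm_itv t (m + k); rewrite exprS invfM.
have -> : 2 * (2^-1 / 2 ^+ (m + k)) = (2 ^+ (m + k))^-1 :> R.
  by field; rewrite expf_neq0// pnatr_eq0.
lra.
Qed.

Lemma wsum_le t k n : wsum a phi t n <= wsum a phi t k + 2 / 2 ^+ k.
Proof.
have p m : 0 <= 2 / 2 ^+ m :> R by rewrite divr_ge0// exprn_ge0.
have [kn|nk] := leqP k n.
  by have [_] := wsum_bounds t k n kn; have := p n; lra.
by have [+ _] := wsum_bounds t n k (ltnW nk); have := p k; lra.
Qed.

End Monotone.

(** For weights in [[0, 1]] the partial sums increase, so that this supremum is
the sum of the series. *)
Definition height a t : R := sup (range (wsum a jump t)).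

Lemma height_bounds a t k : (forall n, 0 <= a n <= 1) ->
  wsum a jump t k <= height a t <= wsum a jump t k + 2 / 2 ^+ k.
Proof.
move=> a01; apply/andP; split.
  apply: ub_le_sup; last by exists k.
  exists (wsum a jump t 0 + 2 / 2 ^+ 0) => _ [n _ <-].
  exact: wsum_le jump_itv _ _ _.
apply: ge_sup; first by exists (wsum a jump t 0), 0.
by move=> _ [n _ <-]; exact: wsum_le jump_itv _ _ _.
Qed.

Lemma wsum_run a b phi t k m :
  (forall n, (k <= n < k + m)%N -> a n = b) ->
  wsum a phi t (k + m) - wsum a phi t k =
  b * (wsum (fun=> 1) phi t (k + m) - wsum (fun=> 1) phi t k).
Proof.
elim: m => [|m IH] ab; first by rewrite addn0 !subrr mulr0.
rewrite addnS !wsumS ab ?leq_addr ?addnS ?leqnn//.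
rewrite addrAC IH; first by ring.
by move=> n /andP[kn nm]; apply: ab; rewrite kn addnS ltnW.
Qed.

(** The terms with [k <= n < k + m] all have the factor [x - b], and their sum is
at most [|x - b|] times the remainder of [t] after [k] digits, which is at most
[2 / 2 ^+ k]. The terms after them amount to a remainder of [t] and a tail of
[height a t] after [k + m] digits; both are between 0 and [2 / 2 ^+ (k + m)], and
so is the former times [x], whence their difference is at most this bound. *)
Lemma line_near_truncation a b k m x t :
  (forall n, 0 <= a n <= 1) -> (forall n, (k <= n < k + m)%N -> a n = b) ->
  0 <= x <= 1 -> 0 <= t <= 1 ->
  `|x * t - height a t - \sum_(n < k) (x - a n) * digit jump t n / 2 ^+ n|
  <= 2 / 2 ^+ k * (`|x - b| + (2 ^+ m)^-1).
Proof.
move=> a01 ab x01 t01.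
have -> : \sum_(n < k) (x - a n) * digit jump t n / 2 ^+ n =
    x * wsum (fun=> 1) jump t k - wsum a jump t k.
  rewrite /wsum mulr_sumr -sumrB; apply: eq_bigr => n _.
  by rewrite mul1r !mulrBl mulrA.
have run := wsum_run a b jump t k m ab.
have one01 (n : nat) : 0 <= (1 : R) <= 1 by rewrite ler01 lexx.
have hM := height_bounds a t (k + m) a01.
have orbE n : 0 <= t - wsum (fun=> 1) jump t n <= 2 / 2 ^+ n.
  have o := orbit_jump t n t01.
  have -> : t - wsum (fun=> 1) jump t n = doubling_orbit jump t n / 2 ^+ n.
    by rewrite {1}(expansion jump t n) addrC addKr.
  have i0 : 0 <= (2 ^+ n)^-1 :> R by rewrite invr_ge0 exprn_ge0.
  by move/andP: o => [d0 d2]; rewrite mulr_ge0//= ler_wpM2r.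
have tM := orbE (k + m)%N; have tk := orbE k.
have [Pm _] := wsum_bounds (fun=> 1) jump one01 jump_itv t k (k + m)
  (leq_addr _ _).
clear one01.
have eM : 2 / 2 ^+ (k + m) = 2 / 2 ^+ k * (2 ^+ m)^-1 :> R.
  by rewrite exprD invfM mulrA.
rewrite {}eM in hM tM; rewrite mulrDr.
set E := 2 / 2 ^+ k * (2 ^+ m)^-1 in hM tM *; set D := 2 / 2 ^+ k in tk *.
set P := wsum (fun=> 1) jump t (k + m) in run tM Pm *.
set p := wsum (fun=> 1) jump t k in run tk Pm *.
set A := wsum a jump t (k + m) in run hM *; set A' := wsum a jump t k in run *.
set h := height a t in hM *.
have -> : x * t - h - (x * p - A') =
    (x - b) * (P - p) + (x * (t - P) - (h - A)).
  have -> : A' = A - b * (P - p) by rewrite -run; ring.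
  by ring.
apply: le_trans (ler_normD _ _) _; apply: lerD.
  rewrite normrM mulrC; apply: ler_wpM2r => //.
  by rewrite ger0_norm; lra.
have xt : 0 <= x * (t - P) <= E.
  have [x0 x1] := andP x01; have [t0 t1] := andP tM.
  by rewrite mulr_ge0//=; apply: le_trans t1; rewrite ler_piMl.
by rewrite ler_norml; lra.
Qed.

End Expansions.

(** * The height function is of Baire class 1 *)

Section Approximation.
Context {R : realType}.
Implicit Types (a : nat -> R) (t v : R).

Definition ramp (N : nat) v : R := Num.min 1 (Num.max 0 (1 + N%:R * (v - 1))).

Lemma ramp_itv N v : 0 <= ramp N v <= 1.
Proof. by rewrite /ramp ge_min le_min lexx ler01 le_max lexx. Qed.

Lemma ramp_continuous N : continuous (ramp N).
Proof.
have affine : continuous (fun v : R => 1 + N%:R * (v - 1)).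
  move=> v; apply: cvgD; first exact: cvg_cst.
  by apply: cvgMr => //; apply: cvgB => //; exact: cvg_cst.
move=> v; apply: (@continuous_min R R (cst 1)
  (fun v => Num.max 0 (1 + N%:R * (v - 1)))); first exact: cvg_cst.
apply: (@continuous_max R R (cst 0) (fun v => 1 + N%:R * (v - 1))).
  exact: cvg_cst.
exact: affine.
Qed.

(** The ramp is exactly 1 from the jump onwards and exactly 0 as soon as
[N * (1 - v) >= 1]: the approximation is eventually exact at each point. This
makes it stable under composition although [jump] is discontinuous. *)
Lemma ramp_eq_jump v : \forall N \near \oo, ramp N v = jump v.
Proof.
rewrite /ramp /jump; have [v1|v1] := leP 1 v.
  apply: nearW => N; apply/min_idPl; rewrite le_max lerDl.
  by rewrite mulr_ge0 ?subr_ge0 ?orbT.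
have v1' : 0 < 1 - v by rewrite subr_gt0.
near=> N.
have h : 1 <= N%:R * (1 - v).
  rewrite -ler_pdivrMr// div1r.
  by near: N; exact: nbhs_infty_ger.
rewrite (max_idPl _); last by move: h; rewrite -opprB mulrN; lra.
by apply/min_idPr.
Unshelve. all: by end_near. Qed.

Lemma orbit_ramp_eq_jump t n :
  \forall N \near \oo, doubling_orbit (ramp N) t n = doubling_orbit jump t n.
Proof.
elim: n => [|n IH]; first by apply: nearW.
near=> N => /=.
have -> : doubling_orbit (ramp N) t n = doubling_orbit jump t n by near: N.
by congr (2 * (_ - _)); near: N; exact: ramp_eq_jump.
Unshelve. all: by end_near. Qed.

Lemma wsum_ramp_eq_jump a t k :
  \forall N \near \oo, wsum a (ramp N) t k = wsum a jump t k.
Proof.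
elim: k => [|k IH]; first by apply: nearW => N; rewrite !wsum0.
near=> N; rewrite !wsumS.
have -> : wsum a (ramp N) t k = wsum a jump t k by near: N.
rewrite /digit; have -> : doubling_orbit (ramp N) t k = doubling_orbit jump t k.
  by near: N; exact: orbit_ramp_eq_jump.
by congr (_ + _ * _ / _); near: N; exact: ramp_eq_jump.
Unshelve. all: by end_near. Qed.

(** For large [N] the first [k] terms are those of [height a t], and the tail
bound does not depend on the threshold function, so it applies to both sides. *)
Lemma wsum_ramp_cvg a t : (forall n, 0 <= a n <= 1) ->
  wsum a (ramp N) t N @[N --> \oo] --> height a t.
Proof.
move=> a01; apply/cvgrPdist_lt => e e0.
have e20 : 0 < e / 2 by rewrite divr_gt0.
have [k _ /(_ k (leqnn _))/= ke] := near_infty_natSinv_expn_lt (PosNum e20).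
near=> N.
have Nk : (k <= N)%N by near: N; exact: nbhs_infty_ge.
have eqk : wsum a (ramp N) t k = wsum a jump t k.
  by near: N; exact: wsum_ramp_eq_jump.
have [lb ub] := wsum_bounds a (ramp N) a01 (ramp_itv N) t k N Nk.
have := height_bounds a t k a01; rewrite -eqk.
have : 0 <= 2 / 2 ^+ N :> R by rewrite divr_ge0// exprn_ge0.
have : 2 / 2 ^+ k = 2 * (1 / 2 ^+ k) :> R by rewrite div1r.
by move=> h1 h2 h3; rewrite ltr_norml; lra.
Unshelve. all: by end_near. Qed.

Lemma orbit_continuous (phi : R -> R) n : continuous phi ->
  continuous (fun t => doubling_orbit phi t n).
Proof.
move=> cphi; elim: n => [|n IH] t /=; first exact: cvg_id.
apply: cvgMr; apply: cvgB; first exact: IH.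
apply: (@continuous_comp _ _ _ (fun t => doubling_orbit phi t n) phi).
  exact: IH.
exact: cphi.
Qed.

Lemma wsum_continuous a (phi : R -> R) k : continuous phi ->
  continuous (fun t => wsum a phi t k).
Proof.
move=> cphi; elim: k => [|k IH] t.
  by under eq_fun do rewrite wsum0; exact: cvg_cst.
under eq_fun do rewrite wsumS.
rewrite /continuous_at; apply: cvgD; first exact: IH.
apply: cvgMl; apply: cvgMr.
apply: (@continuous_comp _ _ _ (fun t => doubling_orbit phi t k) phi).
  exact: orbit_continuous.
exact: cphi.
Qed.

End Approximation.

(** * Weights that are constant on dyadic blocks *)

Section Blocks.
Context {R : realType}.

(** As [j.+1 = 2 ^ i + l] with [l < 2 ^ i] runs through the [i]-th dyadic block,
[dyadic j = l / 2 ^ i] runs through the grid of mesh [1 / 2 ^ i], 1 excluded. The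
shift [j.+1] avoids the logarithm of 0. *)
Definition dyadic (j : nat) : R := j.+1%:R / 2 ^+ trunc_log 2 j.+1 - 1.

Definition weight (n : nat) : R := dyadic (trunc_log 2 n).

Lemma dyadic_itv j : 0 <= dyadic j <= 1.
Proof.
rewrite /dyadic; set l := trunc_log 2 j.+1.
have /andP[lo hi] : (2 ^ l <= j.+1 < 2 ^ l.+1)%N by exact: trunc_log_bounds.
have p : 0 < 2 ^+ l :> R by rewrite exprn_gt0.
have lo' : 2 ^+ l <= j.+1%:R :> R by rewrite -natrX ler_nat.
have hi' : j.+1%:R <= 2 * 2 ^+ l :> R by rewrite -exprS -natrX ler_nat ltnW.
rewrite subr_ge0 ler_pdivlMr// mul1r lo' lerBlDr ler_pdivrMr//.
Qed.

Lemma weight_itv n : 0 <= weight n <= 1.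
Proof. exact: dyadic_itv. Qed.

Lemma weight_block j n : (2 ^ j <= n < 2 ^ j + 2 ^ j)%N -> weight n = dyadic j.
Proof.
by rewrite addnn -mul2n -expnS /weight => /trunc_log_eq ->.
Qed.

Lemma dyadic_near (x : R) i : 0 <= x <= 1 ->
  exists2 j, (i <= j)%N & `|x - dyadic j| <= (2 ^+ i)^-1.
Proof.
move=> /andP[x0 x1]; have p : 0 < 2 ^+ i :> R by rewrite exprn_gt0.
have [l li lx] : exists2 l, (l < 2 ^ i)%N & `|x - l%:R / 2 ^+ i| <= (2 ^+ i)^-1.
  have [xlt1|xge1] := ltP x 1.
    have xi0 : 0 <= x * 2 ^+ i by rewrite mulr_ge0// ltW.
    have /andP[lo hi] := truncn_itv xi0.
    exists (Num.truncn (x * 2 ^+ i)).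
      rewrite -(ltr_nat R) natrX; apply: le_lt_trans lo _.
      by rewrite gtr_pMl.
    have -> : x - (Num.truncn (x * 2 ^+ i))%:R / 2 ^+ i =
        (x * 2 ^+ i - (Num.truncn (x * 2 ^+ i))%:R) / 2 ^+ i.
      by rewrite mulrBl mulfK// gt_eqF.
    rewrite normrM [X in _ * X]gtr0_norm ?invr_gt0// ler_piMl ?invr_ge0 ?ltW//.
    by rewrite ger0_norm ?subr_ge0// ltrBlDr addrC natr1.
  (* The right end point is not on the grid: its last point is used. *)
  have -> : x = 1 by lra.
  exists (2 ^ i).-1; first by rewrite prednK ?expn_gt0.
  have -> : 1 - (2 ^ i).-1%:R / 2 ^+ i = (2 ^+ i)^-1 :> R.
    rewrite -[X in X - _](mulfV (lt0r_neq0 p)) -mulrBl -natrX.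
    rewrite -{1}(prednK (_ : 0 < 2 ^ i)%N) ?expn_gt0// -natr1 addrAC subrr.
    by rewrite add0r mul1r.
  by rewrite ger0_norm// invr_ge0 ltW.
have li1 : (2 ^ i <= 2 ^ i + l < 2 ^ i.+1)%N.
  by rewrite leq_addr expnS mul2n -addnn ltn_add2l.
have pi : (0 < 2 ^ i + l)%N by rewrite addn_gt0 expn_gt0.
exists (2 ^ i + l).-1.
  by rewrite -ltnS prednK//; apply: leq_trans (leq_addr _ _); rewrite ltn_expl.
rewrite /dyadic prednK// (trunc_log_eq _ li1)// natrD natrX mulrDl.
rewrite mulfV ?lt0r_neq0//.
by rewrite [X in X - 1]addrC addrK.
Qed.

End Blocks.

(** * Covers by vertical tubes and Fubini *)

Section Covering.
Context {R : realType}.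
Local Notation mu := (@lebesgue_measure R).

Lemma lebesgue_measure_cover_le (I : finType) (c : I -> R) (r : R)
    (A : set R) : measurable A -> 0 <= r ->
  (forall y, A y -> exists i, `|y - c i| <= r) ->
  (mu A <= (#|I|%:R * (2 * r))%:E)%E.
Proof.
move=> mA r0 cover.
pose J i : set R := `[c i - r, c i + r]%classic.
have mJ (s : seq I) : measurable (\big[setU/set0]_(i <- s) J i).
  by apply: bigsetU_measurable => i _; exact: measurable_itv.
have muJ (s : seq I) :
    (mu (\big[setU/set0]_(i <- s) J i) <= ((size s)%:R * (2 * r))%:E)%E.
  elim: s => [|i s IH]; first by rewrite big_nil measure0 mul0r.
  rewrite big_cons /= -natr1 mulrDl mul1r addrC EFinD.
  apply: le_trans (measureU2 _ _ _) _ ; [exact: measurable_itv|exact: mJ|].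
  apply: leeD => //; rewrite /J /= lebesgue_measure_itv/=.
  case: ifP => _; last by rewrite lee_fin mulr_ge0.
  by rewrite -EFinD lee_fin; lra.
rewrite cardE; apply: le_trans (muJ (enum I)).
apply: le_measure; [by rewrite inE|by rewrite inE; exact: mJ|].
move=> y /cover[i yi].
rewrite -bigcup_seq; exists i; first by rewrite /= mem_enum.
by rewrite /J /= in_itv/= -ler_distl.
Qed.

(** Tonelli: the product measure is by definition the integral of the measures of
the vertical sections. *)
Lemma null_of_null_sections (A : set (R * R)) : measurable A ->
  (forall x e, 0 < e -> (mu (xsection A x) <= e%:E)%E) ->
  (mu \x mu)%E.-negligible A.
Proof.
move=> mA small; apply/negligibleP => //.
apply: integral0_eq => x _ /=; apply/eqP; rewrite -measure_le0.
by apply/lee_addgt0Pr => e e0; rewrite add0e; exact: small.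
Qed.

Definition tube {I : Type} (c : I -> R -> R) (r : R -> R) : set (R * R) :=
  [set p | exists i, `|p.2 - c i p.1| <= r p.1].

Lemma measurable_tube (I : finType) (c : I -> R -> R) (r : R -> R) :
  (forall i, continuous (c i)) -> continuous r -> measurable (tube c r).
Proof.
move=> cc cr.
have -> : tube c r =
    \bigcup_(i in [set: I]) [set p | `|p.2 - c i p.1| <= r p.1].
  by apply/seteqP; split=> p [i]; [exists i|exists i].
apply: fin_bigcup_measurable; first exact: finite_finset.
move=> i _; rewrite -[X in measurable X]setTI; apply: measurable_fun_le => //.
  apply: measurableT_comp => //; apply: measurable_funB => //.
  by apply: measurableT_comp => //; exact: continuous_measurable_fun.
by apply: measurableT_comp => //; exact: continuous_measurable_fun.
Qed.

End Covering.

(** * The Kakeya set *)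

Section Kakeya.
Context {R : realType}.
Local Notation mu := (@lebesgue_measure R).

Definition truncation {k : nat} (w : {ffun 'I_k -> bool}) (x : R) : R :=
  \sum_(n < k) (x - weight n) * (w n)%:R / 2 ^+ n.

Definition radius (k : nat) (b x : R) : R :=
  2 / 2 ^+ k * (`|x - b| + (2 ^+ k)^-1).

Definition block_tube (j : nat) : set (R * R) :=
  tube (@truncation (2 ^ j)) (radius (2 ^ j) (dyadic j)).

(** For each [x] some block has its value [dyadic j] close to [x], but it depends
on [x]; the intersection over all [j] lets the block be chosen after [x], so that
every section is null. *)
Definition kakeya_cover : set (R * R) :=
  (`[0, 1]%classic `*` setT) `&` \bigcap_j block_tube j.

Lemma truncation_continuous k (w : {ffun 'I_k -> bool}) :
  continuous (truncation w).
Proof.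
apply: continuous_big => [|n _ x]; first exact: add_continuous.
by do 2![apply: cvgMl]; apply: cvgB; [exact: cvg_id|exact: cvg_cst].
Qed.

Lemma radius_continuous k b : continuous (radius k b).
Proof.
move=> x; apply: cvgMr; apply: cvgD; last exact: cvg_cst.
by apply: cvg_norm; apply: cvgB; [exact: cvg_id|exact: cvg_cst].
Qed.

Lemma measurable_kakeya_cover : measurable kakeya_cover.
Proof.
apply: measurableI; first by apply: measurableX => //; exact: measurable_itv.
apply: bigcap_measurableType => j _; apply: measurable_tube.
  by move=> w; exact: truncation_continuous.
exact: radius_continuous.
Qed.

Lemma kakeya_cover_section_le x j : 0 <= x <= 1 ->
  (mu (xsection kakeya_cover x) <=
    (4 * (`|x - dyadic j| + (2 ^+ (2 ^ j))^-1))%:E)%E.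
Proof.
move=> x01.
have r0 : 0 <= radius (2 ^ j) (dyadic j) x.
  by rewrite mulr_ge0 ?divr_ge0 ?addr_ge0 ?invr_ge0 ?exprn_ge0.
apply: le_trans (lebesgue_measure_cover_le
  {ffun 'I_(2 ^ j) -> bool} (fun w => truncation w x) _ _ _ r0 _) _.
- by apply: measurable_xsection; exact: measurable_kakeya_cover.
- by move=> y /xsectionP[_ /(_ j I)].
  (* [2 ^ k] intervals of length [2 * radius] with [k = 2 ^ j] *)
- rewrite card_ffun card_bool card_ord natrX lee_fin /radius.
  rewrite le_eqVlt; apply/orP; left; apply/eqP.
  by field; rewrite expf_neq0// pnatr_eq0.
Qed.

Lemma kakeya_cover_negligible : (mu \x mu)%E.-negligible kakeya_cover.
Proof.
apply: null_of_null_sections; first exact: measurable_kakeya_cover.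
move=> x e e0; have [x01|x01] := boolP (0 <= x <= 1); last first.
  rewrite (_ : xsection kakeya_cover x = set0) ?measure0 ?lee_fin ?ltW//.
  apply/seteqP; split=> // y /xsectionP[[+ _] _].
  by rewrite /= in_itv/= (negbTE x01).
have e80 : 0 < e / 8 by rewrite divr_gt0.
have [i _ /(_ i (leqnn i))/= ie] := near_infty_natSinv_expn_lt (PosNum e80).
have [j ij xj] := dyadic_near x i x01.
apply: le_trans (kakeya_cover_section_le x j x01) _; rewrite lee_fin.
have : (2 ^+ (2 ^ j))^-1 <= (2 ^+ i)^-1 :> R.
  rewrite lef_pV2 ?posrE ?exprn_gt0// ler_weXn2l ?ler1n//.
  by apply: leq_trans ij _; rewrite ltnW// ltn_expl.
by rewrite div1r in ie; lra.
Qed.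

Lemma line_in_kakeya_cover (s x : R) : 0 <= s <= 1 -> 0 <= x <= 1 ->
  kakeya_cover (x, s * x - height weight s).
Proof.
move=> s01 x01; split; first by split => //=; rewrite in_itv.
move=> j _; exists [ffun n : 'I_(2 ^ j) => 1 <= doubling_orbit jump s n] => /=.
have := line_near_truncation weight (dyadic j) (2 ^ j) (2 ^ j) x s
  weight_itv (weight_block j) x01 s01.
rewrite (mulrC x); congr (`|_ - _| <= _); apply: eq_bigr => n _.
by rewrite ffunE.
Qed.

Definition width (s : R) : R := (Num.sqrt (1 + s ^+ 2))^-1.

Definition needle (c s : R) : compacts2 R :=
  segment (0, c) (width s, s * width s + c).

Lemma sqrt_1Dsqr_ge1 (s : R) : 1 <= Num.sqrt (1 + s ^+ 2).
Proof. by rewrite -[leLHS]sqrtr1 ler_wsqrtr// lerDl sqr_ge0. Qed.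

Lemma width_itv s : 0 <= width s <= 1.
Proof.
have h := sqrt_1Dsqr_ge1 s.
by rewrite /width invr_ge0 invf_le1 ?h ?andbT ?sqrtr_ge0//; lra.
Qed.

Lemma width_continuous : continuous width.
Proof.
move=> s; apply: cvgV; first by have := sqrt_1Dsqr_ge1 s; lra.
apply: (@continuous_comp _ _ _ (fun s : R => 1 + s ^+ 2) Num.sqrt); last first.
  exact: sqrt_continuous.
apply: cvgD; first exact: cvg_cst.
exact: exprn_continuous.
Qed.

Lemma needle_on_line c s p : compacts2_set (needle c s) p ->
  0 <= p.1 <= 1 /\ p.2 = s * p.1 + c.
Proof.
case=> t /=; rewrite in_itv/= => /andP[t0 t1] <- /=; split; last by ring.
have /andP[w0 w1] := width_itv s.
by rewrite mulr0 add0r mulr_ge0//= mulr_ile1.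
Qed.

Lemma needle_unit c s : unit_segment (needle c s).
Proof.
exists (0, c), (width s, s * width s + c); split=> //.
rewrite /edist2 /= (_ : _ + _ = 1) ?sqrtr1//.
have q0 : 0 <= 1 + s ^+ 2 by rewrite addr_ge0 ?sqr_ge0.
have -> : (0 - width s) ^+ 2 + (c - (s * width s + c)) ^+ 2 =
    (1 + s ^+ 2) * width s ^+ 2 by ring.
rewrite /width exprVn sqr_sqrtr// mulfV// gt_eqF//.
by have := sqr_ge0 s; lra.
Qed.

Lemma cvg_needle (T : Type) (F : set_system T) (FF : Filter F)
    (c s : T -> R) c0 s0 :
  c x @[x --> F] --> c0 -> s x @[x --> F] --> s0 ->
  needle (c x) (s x) @[x --> F] --> needle c0 s0.
Proof.
move=> cc ss.
have ww : width (s x) @[x --> F] --> width s0.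
  exact: (@cvg_comp _ _ _ s width _ _ _ ss (width_continuous s0)).
apply: cvg_segment => //=; first exact: cvg_cst.
by apply: cvgD => //; exact: cvgM.
Qed.

End Kakeya.

Theorem theorem1 (R : realType) :
  exists f : R -> compacts2 R,
    [/\ baire1 f `[0, 1],
        (@lebesgue_measure R \x @lebesgue_measure R)%E.-negligible
          (\bigcup_(s in `[0, 1]) (f s : set (R * R)))
      & forall s : R, s \in `[0, 1] ->
          unit_segment (f s) /\ has_slope s (f s)].
Proof.
exists (fun s => needle (- height weight s) s); split.
- exists (fun N s => needle (- wsum weight (ramp N) s N) s); split.
    move=> N; apply: continuous_subspaceT => s; apply: cvg_needle => //.
    by apply: cvgN; apply: wsum_continuous; exact: ramp_continuous.
  move=> s _; apply: cvg_needle; last exact: cvg_cst.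
  by apply: cvgN; apply: wsum_ramp_cvg; exact: weight_itv.
- apply: negligibleS kakeya_cover_negligible => -[x y] [s /= s01].
  move=> /needle_on_line[/= x01 ->]; apply: line_in_kakeya_cover x01.
  by move: s01; rewrite in_itv.
- move=> s _; split; first exact: needle_unit.
  by exists (- height weight s) => p /needle_on_line[].
Qed.
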